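(* Let $R$ be a commutative finite chain ring of nilpotency index $e$ and residue field $\mathbb{F}_q$, and let $n$ be a positive integer. Then \[d_n(R,0)=q^{ne}-(q-1)^n q^{(e-1)n}\sum_{i=0}^{e-1}\binom{n+i-1}{n-1}q^{-i}.\]
   Context: A commutative finite chain ring (CFCR) is a finite commutative ring $R$ with identity $1\neq 0$ whose ideals are linearly ordered by inclusion. Its unique maximal ideal is principal; for a generator $\gamma$ of it, the nilpotency index of $R$ is the smallest positive integer $e$ with $\gamma^e=0$, and the residue field is $R/\gamma R\cong\mathbb{F}_q$ for a prime power $q$. For a commutative ring $S$, $n\in\mathbb{N}$ and $a\in S$, $d_n(S,a)$ denotes the number of $n\times n$ diagonal matrices over $S$ with determinant $a$. *)

(* Defs.v *)
From HB Require Import structures.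
From mathcomp Require Import all_boot all_order all_algebra.

Set Implicit Arguments.
Unset Strict Implicit.
Unset Printing Implicit Defensive.

Import GRing.Theory.
Local Open Scope ring_scope.

(* The ideals of a finite commutative ring, improper ideal included
   (the structure idealr of ring_quotient only covers proper ones). *)
Definition is_ideal (R : finComNzRingType) (I : {set R}) : Prop :=
  [/\ 0 \in I,
      forall x y, x \in I -> y \in I -> x + y \in I
    & forall r x, x \in I -> r * x \in I].

Definition is_maximal_ideal (R : finComNzRingType) (M : {set R}) : Prop :=
  [/\ is_ideal M,
      M <> [set: R]
    & forall J : {set R}, is_ideal J -> M \subset J -> J = M \/ J = [set: R]].

Definition principal_ideal (R : finComNzRingType) (g : R) : {set R} :=
  [set g * r | r : R].

Definition is_chain_ring (R : finComNzRingType) : Prop :=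
  forall I J : {set R}, is_ideal I -> is_ideal J -> I \subset J \/ J \subset I.

Definition is_nilpotency_index (R : finComNzRingType) (g : R) (e : nat) : Prop :=
  [/\ (0 < e)%N,
      g ^+ e = 0
    & forall k : nat, (0 < k)%N -> g ^+ k = 0 -> (e <= k)%N].

(* R / gR is isomorphic to F; the idealr structure I on gR is what allows
   the quotient ring {ideal_quot I} to be formed. *)
Definition quotient_isomorphic (R : finComNzRingType) (g : R)
    (F : finFieldType) : Prop :=
  exists I : idealr R, I =i principal_ideal g /\
    exists f : {rmorphism {ideal_quot I} -> F}, bijective f.

Definition num_diag_det (n : nat) (S : finComPzRingType) (a : S) : nat :=
  #|[set A : 'M[S]_n | is_diag_mx A && (\det A == a)]|.

(* Main.v *)
(** Every x in R is u * gamma ^ v with u mapped to a nonzero element of F and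
    v = v(x) <= e, so a product of entries vanishes iff their valuations sum to
    at least e. Each quotient gamma^k R / gamma^(k+1) R with k < e has q
    elements, hence (q - 1) * q ^ (e - 1 - k) elements have valuation k. With
    P = \sum_x 'X^(v x), the coefficient of 'X^k in P ^ n counts the n-tuples
    of total valuation k; below degree e, P agrees with the geometric series
    (q - 1) * q ^ (e - 1) / (1 - 'X / q), whose n-th power has binomial
    coefficients. The nonzero products are then the first e coefficients. *)
Require Import Defs.
From HB Require Import structures.
From mathcomp Require Import all_boot all_order all_algebra ring.

Set Implicit Arguments.
Unset Strict Implicit.
Unset Printing Implicit Defensive.

Import GRing.Theory Num.Theory.
Local Open Scope ring_scope.

(** Every fibre of [f] on [A] over a point of the image is a translate of the kernel in [A]. *)
Lemma card_additive_ker (U V : finZmodType) (f : U -> V) (A : {set U}) :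
    {morph f : x y / x - y} -> {in A &, forall x y, x - y \in A} ->
  #|A| = (#|f @: A| * #|[set x in A | f x == 0%R]|)%N.
Proof.
move=> fB AB; rewrite -[LHS]sum1_card (partition_big_imset f) /=.
rewrite -sum_nat_const; apply: eq_bigr => _ /imsetP[a aA ->].
rewrite sum1dep_card -(card_imset _ (subIr a)).
apply: eq_card => x; rewrite [RHS]inE.
apply/imsetP/andP => [[y]|[xA /eqP fx]].
  by rewrite inE => /andP[yA /eqP fy] ->; rewrite AB //= fB fy subrr.
have A0 : 0 \in A by rewrite -(subrr a) AB.
exists (x + a); last by rewrite addrK.
rewrite inE -{1}[a]opprK -{1}[- a]sub0r !AB ?AB //=.
by rewrite -subr_eq0 -fB addrK fx.
Qed.

(** Hockey-stick identity: it sums the Cauchy product with one more geometric factor in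
    [coef_exp_geometric]. *)
Lemma sum_bin_diag (n k : nat) :
  (\sum_(j < k.+1) 'C(n + j - 1, j) = 'C(n + k, k))%N.
Proof.
elim: k => [|k IHk]; first by rewrite big_ord1 !bin0.
by rewrite big_ord_recr /= IHk addnS subn1 /= binS addnC.
Qed.

(* At n = 0 the truncated 'C(k - 1, k) is 1 for k = 0 and 0 otherwise, so the
   formula also covers that case. *)
Lemma coef_exp_geometric (S : comNzRingType) (p : {poly S}) (c r : S)
    (e : nat) :
    (forall k, (k < e)%N -> p`_k = c * r ^+ k) ->
  forall n k, (k < e)%N -> (p ^+ n)`_k = 'C(n + k - 1, k)%:R * c ^+ n * r ^+ k.
Proof.
move=> pE; elim=> [|n IHn] k ke.
  rewrite expr0 coef1 mulr1; case: k ke => [|k] _; first by rewrite mulr1.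
  by rewrite add0n subn1 bin_small // mul0r.
rewrite exprSr coefM addSn subn1 /= -sum_bin_diag natr_sum !mulr_suml.
apply: eq_bigr => -[j /=]; rewrite ltnS => jk _.
rewrite IHn ?pE ?(leq_ltn_trans _ ke) ?leq_subr //.
by rewrite mulrACA -mulrA -exprD subnKC // exprSr !mulrA.
Qed.

Lemma card_principal_ideal_ker (R : finComNzRingType) (F : finFieldType)
    (h : {rmorphism R -> F}) (g : R) :
    (forall y, exists x, h x = y) ->
    (forall x, (h x == 0) = (x \in principal_ideal g)) ->
  #|R| = (#|F| * #|principal_ideal g|)%N.
Proof.
move=> hsurj hker; rewrite -cardsT (@card_additive_ker _ _ h) //=; last first.
  exact: rmorphB.
congr (_ * _)%N; last by apply: eq_card => x; rewrite !inE hker.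
apply: eq_card => y; rewrite [RHS]inE; apply/imsetP.
by have [x <-] := hsurj y; exists x; rewrite ?inE.
Qed.

Section ChainRing.

Variables (R : finComNzRingType) (F : finFieldType) (h : {rmorphism R -> F}).
Variables (g : R) (e : nat).
Hypothesis hsurj : forall y, exists x, h x = y.
Hypothesis hker : forall x, (h x == 0) = (x \in principal_ideal g).
Hypothesis ge : is_nilpotency_index g e.

Local Notation I k := (principal_ideal (g ^+ k)).

Lemma expr_eq0_nilpotency m : (g ^+ m == 0) = (e <= m)%N.
Proof.
have [e0 ge0 gmin] := ge; apply/eqP/idP => [|em]; last first.
  by rewrite -(subnKC em) exprD ge0 mul0r.
case: m => [/eqP|m gm]; first by rewrite expr0 oner_eq0.
exact: gmin.
Qed.

Lemma principal_expP k x : reflect (exists r, x = g ^+ k * r) (x \in I k).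
Proof. by apply: (iffP imsetP) => -[r]; exists r. Qed.

Lemma principal_exp_sub i j x : (i <= j)%N -> x \in I j -> x \in I i.
Proof.
move=> ij /principal_expP[r ->]; apply/principal_expP; exists (g ^+ (j - i) * r).
by rewrite mulrA -exprD subnKC.
Qed.

(* h u != 0 says that u is a unit of R, which carries no unitRing structure. *)
Lemma unit_mul_exp_notin m u : h u != 0 -> (m < e)%N -> u * g ^+ m \notin I m.+1.
Proof.
move=> hu0; rewrite ltnNge -expr_eq0_nilpotency; apply: contra.
move=> /principal_expP[t ugm].
have [r hr] := hsurj (h u)^-1.
have : 1 - u * r \in principal_ideal g.
  by rewrite -hker rmorphB rmorph1 rmorphM hr divff // subrr.
move=> /imsetP[s _ urs].
(* Nakayama-style argument: splitting 1 as (1 - u r) + u r shows that a multiple of [g] fixes g^m;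
   its e-th power is 0, so g^m = 0. *)
have gm : g ^+ m = g ^+ m * (g * (t * r + s)).
  rewrite -{1}[g ^+ m]mulr1 -[1](subrK (u * r)) urs mulrDr (mulrA _ u).
  by rewrite (mulrC _ u) ugm exprSr; ring.
have gmi i : g ^+ m = g ^+ m * (g * (t * r + s)) ^+ i.
  by elim: i => [|i IHi]; rewrite ?mulr1 // exprSr mulrA -IHi.
have [_ ge0 _] := ge.
by rewrite (gmi e) exprMn ge0 mul0r mulr0.
Qed.

Lemma unit_mul_exp_eq0 m u : h u != 0 -> (u * g ^+ m == 0) = (e <= m)%N.
Proof.
move=> hu0; have [em|me] := leqP e m.
  by move: em; rewrite -expr_eq0_nilpotency => /eqP->; rewrite mulr0 eqxx.
apply: contraNF (unit_mul_exp_notin hu0 me) => /eqP->.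
by apply/principal_expP; exists 0; rewrite mulr0.
Qed.

(** The valuation capped at [e], its value at 0. The default [ord0] is admissible because [I 0] is
    all of [R]. *)
Definition chain_val (x : R) : 'I_e.+1 := [arg max_(k > ord0 | x \in I k) k].

Lemma chain_val_geq k x : (k <= e)%N -> (k <= chain_val x)%N = (x \in I k).
Proof.
move=> ke; rewrite /chain_val; case: arg_maxnP => [|i xi imax].
  by apply/principal_expP; exists x; rewrite mul1r.
apply/idP/idP => [ki|xk]; first exact: principal_exp_sub ki xi.
exact: (imax (Ordinal (ke : (k < e.+1)%N))).
Qed.

(** Below [e], a cofactor killed by [h] would be a multiple of [g] and put [x] in the next power,
    against maximality. At [e], x = 0 and u = 1 will do. *)
Lemma chain_valP x : exists2 u, h u != 0 & x = u * g ^+ chain_val x.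
Proof.
have : x \in I (chain_val x) by rewrite -chain_val_geq // -ltnS.
have [ve|ve] := leqP e (chain_val x).
  move: ve; rewrite -expr_eq0_nilpotency => /eqP-> /imsetP[r _ ->].
  by exists 1; rewrite ?rmorph1 ?oner_eq0 // mul0r mulr0.
move=> /principal_expP[u xu]; exists u; last by rewrite mulrC.
rewrite hker; apply/imsetP => -[w _ uw].
have := chain_val_geq x ve; rewrite ltnn => /esym/negP; apply.
by apply/principal_expP; exists w; rewrite {1}xu uw exprSr mulrA.
Qed.

Lemma prod_eq0_chain_val (J : finType) (f : J -> R) :
  (\prod_j f j == 0) = (e <= \sum_j chain_val (f j))%N.
Proof.
have [u hu ->] : exists2 u, h u != 0 &
    \prod_j f j = u * g ^+ (\sum_j chain_val (f j)).
  elim/big_rec2: _ => [|j m y _ [u hu ->]].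
    by exists 1; rewrite ?rmorph1 ?oner_eq0 // mul1r.
  have [w hw {1}->] := chain_valP (f j); exists (w * u).
    by rewrite rmorphM mulf_neq0.
  by rewrite exprD mulrACA.
exact: unit_mul_exp_eq0.
Qed.

(* Multiplication by g maps I i onto I i.+1 with kernel ann g for every i < e,
   since ann g lies in I e.-1; the case i = 0 gives #|ann g| = #|F|. *)
Lemma card_principal_exp k : (k <= e)%N -> #|I k| = (#|F| ^ (e - k))%N.
Proof.
have [e0 ge0 _] := ge.
pose K := [set x | g * x == 0].
have IB i : {in I i &, forall x y, x - y \in I i}.
  move=> _ _ /principal_expP[x ->] /principal_expP[y ->].
  by apply/principal_expP; exists (x - y); rewrite mulrBr.
have KI x : x \in K -> x \in I e.-1.
  rewrite inE => gx0; rewrite -chain_val_geq ?leq_pred //.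
  have [u hu xE] := chain_valP x; move: gx0.
  by rewrite {1}xE mulrCA -exprS unit_mul_exp_eq0 // -subn1 leq_subLR add1n.
have step i : (i < e)%N -> #|I i| = (#|I i.+1| * #|K|)%N.
  move=> ie; rewrite (@card_additive_ker _ _ ( *%R g)) //; last exact: mulrBr.
  congr (_ * _)%N; apply: eq_card => x.
    apply/imsetP/principal_expP => [[_ /principal_expP[r ->] ->]|[r ->]].
      by exists r; rewrite mulrA exprS.
    exists (g ^+ i * r); last by rewrite mulrA exprS.
    by apply/principal_expP; exists r.
  rewrite !inE andbC; case: eqP => //= /eqP gx0.
  by apply: (@principal_exp_sub _ e.-1); rewrite ?KI ?inE // -ltnS prednK.
have KF : #|K| = #|F|.
  have I0 : #|I 0| = #|R|.
    apply: eq_card => x; rewrite inE.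
    by apply/principal_expP; exists x; rewrite mul1r.
  have := card_principal_ideal_ker hsurj hker; rewrite -I0 step // mulnC expr1.
  move/eqP; rewrite eqn_pmul2r; first by move/eqP.
  by apply/card_gt0P; exists 0; apply/imsetP; exists 0; rewrite ?mulr0.
(* Writing k as e - (e - k) allows induction on e - k, starting from the zero ideal [I e]. *)
move=> ke; rewrite -{1}(subKn ke); have := leq_subr k e.
elim: (e - k)%N => [_|m IHm me].
  rewrite subn0 expn0 -(cards1 (0 : R)); apply: eq_card => x; rewrite inE ge0.
  apply/imsetP/eqP => [[r _ ->]|->]; first by rewrite mul0r.
  by exists 0; rewrite ?mulr0.
rewrite step ?KF; last by rewrite ltn_subrL.
by rewrite -subSn // subSS IHm ?(ltnW me) // expnSr.
Qed.

Lemma card_chain_val k : (k < e)%N ->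
  #|[set x | chain_val x == k :> nat]| = (#|F| ^ (e - k) - #|F| ^ (e - k.+1))%N.
Proof.
move=> ke; rewrite -!card_principal_exp ?(ltnW ke) //.
have /setIidPr <- : I k.+1 \subset I k.
  by apply/subsetP => x; apply: principal_exp_sub.
rewrite -cardsD; apply: eq_card => x.
rewrite !inE -(@chain_val_geq k.+1) // -(@chain_val_geq k) ?(ltnW ke) //.
by rewrite -leqNgt eqn_leq.
Qed.

(** Rational coefficients accommodate the ratio 1/q of the geometric series. *)
Definition val_poly : {poly rat} := \sum_x 'X^(chain_val x).

Lemma coef_val_poly k : (k < e)%N ->
  val_poly`_k = (#|F|%:R - 1) * #|F|%:R ^+ (e - 1) * #|F|%:R^-1 ^+ k.
Proof.
move=> ke; have F0 : #|F|%:R != 0 :> rat.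
  by rewrite pnatr_eq0 -lt0n; apply/card_gt0P; exists 0.
transitivity (#|[set x | chain_val x == k :> nat]|%:R : rat).
  rewrite coef_sum -sum1dep_card natr_sum [RHS]big_mkcond.
  by apply: eq_bigr => x _; rewrite coefXn eq_sym; case: eqP.
rewrite card_chain_val // natrB ?leq_pexp2l ?leq_sub //; last first.
  by apply/card_gt0P; exists 0.
(* Factor q^(e-k) - q^(e-k-1) as (q-1) q^(e-k-1), then multiply by q^k to clear the inverse. *)
rewrite !natrX -(subnSK ke) exprS -{2}[_ ^+ _]mul1r -mulrBl -mulrA.
congr (_ * _); rewrite exprVn; apply: (mulIf (expf_neq0 k F0)).
rewrite mulfVK ?expf_neq0 // -exprD -add1n subnDA subnK //.
by rewrite leq_subRL ?(leq_ltn_trans _ ke).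
Qed.

Lemma card_prod_neq0 (n : nat) :
  #|[set f : {ffun 'I_n -> R} | \prod_j f j != 0]|%:R =
    \sum_(k < e) (val_poly ^+ n)`_k.
Proof.
(* As a product over ['I_n], the power expands into one monomial per function [f], of degree its
   total valuation. *)
rewrite -[n in val_poly ^+ n]card_ord -prodr_const bigA_distr_bigA /=.
under [RHS]eq_bigr do rewrite coef_sum.
rewrite exchange_big /= -sum1dep_card natr_sum big_mkcond /=.
apply: eq_bigr => f _; rewrite prod_eq0_chain_val -ltnNge.
rewrite -expr_sum.
under [RHS]eq_bigr do rewrite coefXn.
(* The monomial of [f] meets the range k < e in one coefficient or in none. *)
case: ltnP => [lt_e|le_e].
  rewrite (bigD1 (Ordinal lt_e)) //= eqxx big1 ?addr0 // => i.
  by rewrite -val_eqE /= => /negPf->.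
by rewrite big1 // => i _; rewrite ltn_eqF // (leq_trans _ le_e).
Qed.

End ChainRing.

Lemma num_diag_det_ffun (n : nat) (S : finComNzRingType) (a : S) :
  num_diag_det n a = #|[set f : {ffun 'I_n -> S} | \prod_j f j == a]|.
Proof.
pose D (f : {ffun 'I_n -> S}) : 'M[S]_n := diag_mx (\row_j f j).
have Dinj : injective D.
  move=> f f' /matrixP DD; apply/ffunP => j; have := DD j j.
  by rewrite !mxE eqxx.
rewrite -(card_imset _ Dinj); apply: eq_card => A; rewrite inE.
apply/andP/imsetP => [[/is_diag_mxP Adiag /eqP detA]|[f]].
  have AD : A = D [ffun j => A j j].
    apply/matrixP => i j; rewrite !mxE ffunE.
    by case: eqVneq => [->//|/Adiag].
  exists [ffun j => A j j] => //; rewrite inE -detA {2}AD det_diag.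
  by apply/eqP/eq_bigr => j _; rewrite mxE.
rewrite inE => /eqP <- ->; split; first exact: diag_mx_is_diag.
by rewrite det_diag; apply/eqP/eq_bigr => j _; rewrite mxE.
Qed.

(** Trades the quotient ring for a surjection with kernel gR, the form in which the residue field
    enters the counting. *)
Lemma quotient_morphism (R : finComNzRingType) (g : R) (F : finFieldType) :
    quotient_isomorphic g F ->
  exists h : {rmorphism R -> F}, (forall y, exists x, h x = y) /\
    (forall x, (h x == 0) = (x \in principal_ideal g)).
Proof.
move=> [I [Ig [f fbij]]].
exists [the {rmorphism R -> F} of f \o \pi_({ideal_quot I})%qT]; split.
  move=> y; have [f' _ fK] := fbij; exists (repr (f' y)).
  by rewrite /= reprK fK.
move=> x; rewrite /= -(rmorph0 f) (inj_eq (bij_inj fbij)).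
by rewrite -(rmorph0 (\pi_({ideal_quot I})%qT)) -Quotient.idealrBE subr0 Ig.
Qed.

Theorem theorem3p6 (R : finComNzRingType) (gamma : R) (e : nat)
    (F : finFieldType) (q : nat) (n : nat)
    (hR : is_chain_ring R)
    (hgamma : is_maximal_ideal (principal_ideal gamma))
    (he : is_nilpotency_index gamma e)
    (hF : quotient_isomorphic gamma F)
    (hq : #|F| = q)
    (hn : (0 < n)%N) :
  (num_diag_det n (0 : R))%:R =
    q%:R ^+ (n * e)
    - (q%:R - 1) ^+ n * q%:R ^+ ((e - 1) * n)
      * \sum_(0 <= i < e) 'C(n + i - 1, n - 1)%:R * q%:R ^- i :> rat.
Proof.
have [h [hsurj hker]] := quotient_morphism hF.
have cardR : #|R| = (q ^ e)%N.
  rewrite -hq -[e in RHS]subn0 -(card_principal_exp hsurj hker he) //.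
  apply/esym/eq_card => x; rewrite [RHS]inE.
  by apply/imsetP; exists x; rewrite ?mul1r.
set Z := [set f : {ffun 'I_n -> R} | \prod_j f j == 0].
have ZC : #|Z|%:R = q%:R ^+ (n * e) - #|~: Z|%:R :> rat.
  apply/esym/eqP; rewrite subr_eq -natrD cardsC card_ffun card_ord cardR.
  by rewrite -expnM mulnC natrX.
rewrite num_diag_det_ffun ZC; congr (_ - _).
have -> : ~: Z = [set f : {ffun 'I_n -> R} | \prod_j f j != 0].
  by apply/setP => f; rewrite !inE.
rewrite (card_prod_neq0 hsurj hker he) big_mkord mulr_sumr.
apply: eq_bigr => i _.
rewrite (coef_exp_geometric (coef_val_poly hsurj hker he)) // hq exprMn -exprM.
rewrite exprVn [_%:R * _]mulrC [RHS]mulrA.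
congr (_ * _%:R / _).
(* The coefficient is 'C(n + i - 1, i); binomial symmetry gives the stated form, with n > 0 making
   the truncated subtraction exact. *)
have -> : (n + i - 1 = n - 1 + i)%N by rewrite addnBAC.
by rewrite -[RHS]bin_sub ?leq_addr // addKn.
Qed.
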